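(* For any (finite) tree $T$, the dominating graph $\mathcal{D}(T)$ has a Hamilton path.
   Context: All graphs are finite and simple. For a graph $H$, a dominating set of $H$ is a set $D\subseteq V(H)$ such that every vertex of $V(H)\setminus D$ is adjacent to a vertex of $D$. The dominating graph $\mathcal{D}(H)$ is the graph whose vertices are all dominating sets of $H$, in which two distinct dominating sets $X,Y$ are adjacent if and only if $Y$ is obtained from $X$ by adding a single vertex of $H$ or deleting a single vertex of $X$ (i.e. $|X\triangle Y|=1$). *)

(* Defs.v *)
From mathcomp Require Import all_boot.

Set Implicit Arguments.
Unset Strict Implicit.
Unset Printing Implicit Defensive.

(* Finite simple graphs. *)
Record sgraph := SGraph {
  vertex :> finType;
  adj : rel vertex;
  adj_sym : symmetric adj;
  adj_irrefl : irreflexive adj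
}.

Definition connected_graph (G : sgraph) : Prop :=
  0 < #|G| /\ forall x y : G, connect (@adj G) x y.

(* The bound on the size is needed because [:: x; y] satisfies [ucycle]
   whenever xy is an edge. *)
Definition acyclic_graph (G : sgraph) : Prop :=
  forall c : seq G, ucycle (@adj G) c -> size c < 3.

Definition is_tree (G : sgraph) : Prop :=
  connected_graph G /\ acyclic_graph G.

Definition has_hamilton_path (G : sgraph) : Prop :=
  exists (x : G) (p : seq G),
    [/\ path (@adj G) x p, uniq (x :: p) & forall y : G, y \in x :: p].

Definition dominating (G : sgraph) (D : {set G}) : bool :=
  [forall v, (v \notin D) ==> [exists u in D, adj v u]].

Definition symdiff (T : finType) (X Y : {set T}) : {set T} :=
  (X :\: Y) :|: (Y :\: X).

Section DominatingGraph.
Variable G : sgraph.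

Definition dom_set := {D : {set G} | dominating D}.

Definition dom_adj : rel dom_set :=
  fun X Y => #|symdiff (val X) (val Y)| == 1.

Lemma dom_adj_sym : symmetric dom_adj.
Proof. by move=> X Y; rewrite /dom_adj /symdiff setUC. Qed.

Lemma dom_adj_irrefl : irreflexive dom_adj.
Proof. by move=> X; rewrite /dom_adj /symdiff setDv setU0 cards0. Qed.

Definition dominating_graph : sgraph := SGraph dom_adj_sym dom_adj_irrefl.

End DominatingGraph.

(* Main.v *)
(* Induction on forests.  In a forest with an edge and no isolated vertex, the
   second vertex v of a longest path has a nonempty set L of leaves and at most
   one other neighbour w.  Let F be the forest without v and L, let Y be the
   dominating sets of F, and X the sets dominating all of F except possibly w.
   The dominating sets of the whole forest are the y + v + g with y in X and g
   a subset of L, and the y + L with y in Y.  Above each y in Y, put the column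
   y + L, y + v + g_0, ..., y + v + g_m, where g_0 = L, ..., g_m is a cyclic Gray
   code of the subsets of L; a Hamilton path of Y lifts to a path snaking up and
   down the columns.  The remaining sets lie above some c in X but not in Y; then
   c + w is in Y, and the sets above c are visited by a detour inserted between
   the two sets g_0 and g_1 of the column of c + w. *)
Require Import Defs.
From mathcomp Require Import all_boot.

Set Implicit Arguments.
Unset Strict Implicit.
Unset Printing Implicit Defensive.

(** * Single-element changes and Gray codes of power sets *)

Definition flip (T : finType) : rel {set T} := fun X Y => #|symdiff X Y| == 1.

Definition ham_listing (T : finType) (A : {set {set T}}) (p : seq {set T}) :=
  [/\ sorted (@flip T) p, uniq p & p =i A].

Section Flip.
Variable T : finType.
Implicit Types (X Y Z : {set T}) (x : T).

Lemma in_symdiff X Y x : (x \in symdiff X Y) = (x \in X) (+) (x \in Y).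
Proof. by rewrite !inE; case: (x \in X); case: (x \in Y). Qed.

Lemma flip_sym : symmetric (@flip T).
Proof. by move=> X Y; rewrite /flip /symdiff setUC. Qed.

Lemma flip_irrefl : irreflexive (@flip T).
Proof. by move=> X; rewrite /flip /symdiff setDv setU0 cards0. Qed.

Lemma flipU1 X x : x \notin X -> flip (x |: X) X.
Proof.
move=> xX; apply/cards1P; exists x; apply/setP=> z.
rewrite in_symdiff !inE; case: eqP => [->|_] /=; first by rewrite (negbTE xX).
by rewrite addbb.
Qed.

Lemma flipUr Z X Y : [disjoint Z & X] -> [disjoint Z & Y] ->
  flip (Z :|: X) (Z :|: Y) = flip X Y.
Proof.
move=> dX dY; congr (#|pred_of_set _| == 1); apply/setP=> z.
rewrite !in_symdiff !inE.
by case: (boolP (z \in Z)) => //= zZ; rewrite (disjointFr dX zZ) (disjointFr dY zZ).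
Qed.

(** Reflected Gray code: the old code with [x] added everywhere, followed by the old code backwards.
    It ends at [L], one flip away from its start [x |: L], so it closes up into a cycle. *)
Lemma gray_listing_step (L : {set T}) x gs : x \notin L ->
  ham_listing (powerset L) (L :: gs) ->
  let gs' := [seq x |: Y | Y <- gs] ++ rev (L :: gs) in
  ham_listing (powerset (x |: L)) (x |: L :: gs') /\ last (x |: L) gs' = L.
Proof.
move=> xL [sgs ugs mgs] gs'; set l := L :: gs in mgs ugs *.
have xl Y : Y \in l -> x \notin Y.
  by rewrite mgs powersetE => /subsetP YL; apply: contra xL => /YL.
have El : x |: L :: gs' = [seq x |: Y | Y <- l] ++ rev l by [].
have flipx : {in l &, forall X Y, flip (x |: X) (x |: Y) = flip X Y}.
  by move=> X Y /xl xX /xl xY; rewrite flipUr // disjoints1.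
split; last by rewrite last_cat rev_cons last_rcons.
rewrite El; split.
- rewrite -El /= /gs' cat_path last_map.
  have al : all [in l] l by apply/allP.
  rewrite (mono_path_in (e := @flip T) flipx al) [path _ _ _]sgs.
  (* At the junction both sides carry the last term of the old code, with and without [x]. *)
  rewrite lastI rev_rcons /= flipU1 ?xl ?mem_last //=.
  by rewrite rev_path (eq_path (e' := @flip T)) // => X Y; apply: flip_sym.
- rewrite cat_uniq rev_uniq ugs andbT map_inj_in_uniq ?ugs; last first.
    by move=> X Y /xl xX /xl xY /(congr1 (fun Z => Z :\ x)); rewrite !setU1K.
  rewrite andTb; apply/hasPn=> Y; rewrite mem_rev => /xl xY.
  by apply/negP=> /mapP[Z _ YE]; rewrite YE setU11 in xY.
- move=> Y; rewrite mem_cat mem_rev mgs !powersetE; apply/orP/idP => [[/mapP[Z]|]|YxL].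
  + by rewrite mgs powersetE => ZL ->; apply: setUS.
  + by move/subset_trans->; rewrite ?subsetUr.
  have [xY|xY] := boolP (x \in Y); last first.
    by right; rewrite -subDset (setDidPl _) // disjoint_sym disjoints1 in YxL.
  left; apply/mapP; exists (Y :\ x); last by rewrite setD1K.
  by rewrite mgs powersetE subDset.
Qed.

(** The code starts at the full set [L] so that, in a column, [y :|: L] can be followed by the row
    of [L], which differs from it by the centre alone. *)
Lemma gray_listing (L : {set T}) :
  exists gs, ham_listing (powerset L) (L :: gs).
Proof.
have [n] := ubnP #|L|; elim: n L => // n IH L; rewrite ltnS => Ln.
have [->|[x xL]] := set_0Vmem L.
  by exists [::]; split=> // X; rewrite powerset0 !inE.
have [|gs lgs] := IH (L :\ x).
  by rewrite (leq_trans _ Ln) // [in X in _ < X](cardsD1 x) xL.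
by have [] := gray_listing_step (negbT (setD11 x L)) lgs; rewrite setD1K //; eexists; eassumption.
Qed.

Lemma gray_cycle (L : {set T}) : L != set0 ->
  exists gs, ham_listing (powerset L) (L :: gs) /\ flip (last L gs) L.
Proof.
case/set0Pn=> x xL; have [gs lgs] := gray_listing (L :\ x).
have xLx : x \notin L :\ x by rewrite setD11.
have [] := gray_listing_step xLx lgs; rewrite setD1K // => lgs' last_gs'.
eexists; split; first exact: lgs'.
by rewrite last_gs' flip_sym -{1}(setD1K xL) flipU1.
Qed.

End Flip.

(** * Traversing a sequence of columns alternately down and up *)

Section Snake.
Variables (A B : eqType) (eA : rel A) (eB : rel B).
Variables (hd : A -> B) (tl : A -> seq B).
Hypothesis eB_sym : symmetric eB.

(** The flag [b] is set when the column is traversed from its last entry back to [hd y]; [snake_hd]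
    is the entry point and [snake_col] the rest. *)
Definition snake_hd b y := if b then last (hd y) (tl y) else hd y.
Definition snake_col b y := if b then rev (belast (hd y) (tl y)) else tl y.
Fixpoint snake_tl b y ys := snake_col b y ++
  if ys is z :: zs then snake_hd (~~ b) z :: snake_tl (~~ b) z zs else [::].

Lemma last_snake_col b y : last (snake_hd b y) (snake_col b y) = snake_hd (~~ b) y.
Proof.
by case: b => //=; case: (tl y) => //= z s; rewrite rev_cons last_rcons.
Qed.

Lemma perm_snake_col b y :
  perm_eq (snake_hd b y :: snake_col b y) (hd y :: tl y).
Proof.
case: b => //=; rewrite [in X in perm_eq _ X]lastI -rev_rcons.
exact/permPl/perm_rev.
Qed.

Lemma path_snake_col b y :
  path eB (snake_hd b y) (snake_col b y) = path eB (hd y) (tl y).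
Proof. by case: b; rewrite //= rev_path (eq_path (e' := eB)). Qed.

Lemma mem_snake b y ys x : x \in snake_hd b y :: snake_tl b y ys ->
  exists2 z, z \in y :: ys & x \in hd z :: tl z.
Proof.
elim: ys b y => [|z zs IH] b y /=.
  by rewrite cats0 (perm_mem (perm_snake_col b y)); exists y; rewrite ?inE ?eqxx.
rewrite -cat_cons mem_cat => /orP[|/IH[t tz xt]].
  by rewrite (perm_mem (perm_snake_col b y)); exists y; rewrite ?inE ?eqxx.
by exists t; rewrite // inE tz orbT.
Qed.

Lemma sub_snake b y ys x z : z \in y :: ys -> x \in hd z :: tl z ->
  x \in snake_hd b y :: snake_tl b y ys.
Proof.
elim: ys b y => [|t ts IH] b y /=.
  by rewrite cats0 inE => /eqP-> ?; rewrite (perm_mem (perm_snake_col b y)).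
rewrite -cat_cons mem_cat [z \in _]inE => /orP[/eqP-> ?|zt xz].
  by rewrite (perm_mem (perm_snake_col b y)) orbC /= -implyNb; apply/implyP.
by rewrite (IH _ _ zt xz) orbT.
Qed.

(** A column is left at the end where the opposite traversal would enter it. Hence consecutive
    columns only have to be linked top to top and bottom to bottom. *)
Lemma snake_path b y ys :
    (forall z, z \in y :: ys -> path eB (hd z) (tl z)) ->
    (forall b z t, z \in y :: ys -> t \in y :: ys ->
       eA z t -> eB (snake_hd b z) (snake_hd b t)) ->
  path eA y ys -> path eB (snake_hd b y) (snake_tl b y ys).
Proof.
elim: ys b y => [|z zs IH] b y pc cc /=.
  by rewrite cats0 path_snake_col pc ?inE.
case/andP=> yz pz; rewrite cat_path path_snake_col pc ?inE ?eqxx //=.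
rewrite last_snake_col cc ?inE ?eqxx ?orbT //=; apply: IH => // [t tz|b' t u tz uz].
  by rewrite pc // inE tz orbT.
by apply: cc; rewrite inE ?tz ?uz orbT.
Qed.

(* [tag] recovers the column index, so distinct columns are disjoint. *)
Lemma snake_uniq (tag : B -> A) b y ys :
    (forall z, z \in y :: ys -> uniq (hd z :: tl z)) ->
    (forall z x, z \in y :: ys -> x \in hd z :: tl z -> tag x = z) ->
  uniq (y :: ys) -> uniq (snake_hd b y :: snake_tl b y ys).
Proof.
elim: ys b y => [|z zs IH] b y uc tagE.
  by rewrite /= cats0 -cons_uniq (perm_uniq (perm_snake_col b y)) uc ?inE.
rewrite [uniq (y :: _)]cons_uniq => /andP[yz uz]; rewrite /= -cons_uniq -cat_cons cat_uniq.
rewrite (perm_uniq (perm_snake_col b y)) uc ?mem_head //.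
apply/and3P; split=> //; last first.
  by apply: IH => // [t tz|t x tz]; [apply: uc|apply: tagE]; rewrite inE tz orbT.
apply/hasPn=> x /mem_snake[t tz xt]; rewrite (perm_mem (perm_snake_col b y)).
apply: contra yz => xy; suff -> : y = t by [].
by rewrite -(tagE y x) ?inE ?eqxx // (tagE t x) // inE tz orbT.
Qed.

End Snake.

(** * Dominating sets of induced subgraphs *)

Section Domination.
Variable G : sgraph.
Implicit Types (S R D K L : {set G}) (u v w x : G).

Definition dominated D u := (u \in D) || [exists z in D, adj u z].

(** With [R = S] these are the dominating sets of the subgraph induced on [S]. A smaller [R] exempts
    some vertices from being dominated, as is needed for the neighbour [w] of a star centre. *)
Definition doms S R : {set {set G}} :=
  [set D : {set G} | (D \subset S) && [forall u in R, dominated D u]].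

Lemma domsP S R D :
  reflect (D \subset S /\ {in R, forall u, dominated D u}) (D \in doms S R).
Proof.
rewrite inE; apply: (iffP andP) => -[DS dR]; split=> //; first exact/forall_inP.
exact/forall_inP.
Qed.

Lemma dominatedS D D' u : D \subset D' -> dominated D u -> dominated D' u.
Proof.
move=> /subsetP DD' /orP[/DD' uD|/exists_inP[z /DD' zD uz]]; apply/orP; [by left|right].
by apply/exists_inP; exists z.
Qed.

(* [w] is a dummy value outside the remaining forest when all neighbours of [v]
   are leaves. *)
Record pendant_star S v L w : Prop := PendantStar {
  star_center : v \in S;
  star_leaves : L \subset S;
  star_leaves0 : L != set0;
  star_adj : {in L, forall l, adj v l};
  star_leaf : {in L & S, forall l u, adj l u -> u = v};
  star_center_nbr : {in S, forall u, adj v u -> u \in L \/ u = w};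
  star_root : w \in S :\: (v |: L) -> adj v w
}.

(** * Removing a pendant star or an isolated vertex *)

Section Star.
Implicit Types y z g h k : {set G}.
Variables (S L : {set G}) (v w : G).
Hypothesis st : pendant_star S v L w.
Let S0 := S :\: (v |: L).

Lemma star_centerN : v \notin L.
Proof. by apply/negP=> /(star_adj st); rewrite adj_irrefl. Qed.

(** A dominator of [u] lost by restricting to [S0] would be [v] or a leaf. Leaves have no neighbour
    in [S] but [v], and [v] has no neighbour in [S0] except possibly [w], the case excluded by the
    third hypothesis. *)
Lemma star_dominated D u : u \in S0 -> D \subset S ->
  (u = w -> v \notin D) -> dominated D u -> dominated (D :&: S0) u.
Proof.
rewrite !inE negb_or => uS0 DS uw /orP[uD|/exists_inP[z zD uz]]; apply/orP.
  by left; rewrite !inE uD negb_or.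
right; apply/exists_inP; exists z => //; have zS := subsetP DS z zD.
case/andP: uS0 => /andP[uv uL] uS; rewrite !inE zD zS andbT /=.
rewrite negb_or; apply/andP; split; apply/negP.
  move/eqP=> zv; rewrite zv in zD uz; rewrite adj_sym in uz.
  by have [uL1|/uw] := star_center_nbr st uS uz; [rewrite uL1 in uL | rewrite zD].
by move=> /(star_leaf st)/(_ uS); rewrite adj_sym uz => /(_ isT) /eqP; apply/negP.
Qed.

(** If [v] is in [D], it takes care of itself, of all leaves and of [w], so the choice of leaves is
    free. Otherwise each leaf has to dominate itself, and then [v] is dominated because [L] is
    nonempty. *)
Lemma doms_star D : D \subset S -> (D \in doms S S) =
  if v \in D then D :&: S0 \in doms S0 (S0 :\ w)
  else (L \subset D) && (D :&: S0 \in doms S0 S0).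
Proof.
move=> DS; have vL := star_centerN; have vS := star_center st.
have SE u : u \in S -> [\/ u = v, u \in L | u \in S0].
  rewrite !inE => ->; have [->|uv] := eqVneq u v; first by constructor 1.
  by have [uL|uL] := boolP (u \in L); [constructor 2 | constructor 3].
have S0S u : u \in S0 -> u \in S by rewrite inE => /andP[].
case: ifP => vD.
  apply/domsP/domsP=> [[_ dS]|[_ dS]]; split=> //; first exact: subsetIr.
    move=> u; rewrite in_setD1 => /andP[uw uS0]; apply: star_dominated => //.
      by move/eqP: uw.
    exact/dS/S0S.
  move=> u uS; have [->|uL|uS0] := SE u uS; first by rewrite /dominated vD.
    by apply/orP; right; apply/exists_inP; exists v; rewrite // adj_sym (star_adj st).
  have [uw|uw] := eqVneq u w.
    apply/orP; right; apply/exists_inP; exists v => //.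
    by rewrite adj_sym uw (star_root st) // -uw.
  by apply: (dominatedS (subsetIl D S0)); apply: dS; rewrite in_setD1 uw.
apply/domsP/andP=> [[_ dS]|[LD /domsP[_ dS]]]; split=> //.
- apply/subsetP=> l lL; have lS := subsetP (star_leaves st) l lL.
  have /orP[//|/exists_inP[z zD lz]] := dS l lS.
  have zv := star_leaf st lL (subsetP DS z zD) lz.
  by rewrite zv vD in zD.
- apply/domsP; split; first exact: subsetIr.
  by move=> u uS0; apply: star_dominated => // [_|]; [rewrite vD|apply/dS/S0S].
- move=> u uS; have [->|uL|uS0] := SE u uS; last 1 first.
  + by apply: (dominatedS (subsetIl D S0)); apply: dS.
  + have /set0Pn[l lL] := star_leaves0 st; apply/orP; right.
    by apply/exists_inP; exists l; [apply: (subsetP LD)|apply: (star_adj st)].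
  + by rewrite /dominated (subsetP LD).
Qed.

Let X := doms S0 (S0 :\ w).
Let Y := doms S0 S0.

Variable gs : seq {set G}.
Hypothesis gsP : ham_listing (powerset L) (L :: gs).
Hypothesis gs_cycle : flip (last L gs) L.

Let row y g := y :|: (v |: g).
Let detour y := (w \in y) && (y :\ w \in X :\: Y).
Let hd y := y :|: L.
Let tl y := row y L ::
  (if detour y then [seq row (y :\ w) g | g <- L :: rev gs] else [::]) ++
  [seq row y g | g <- gs].
(** The base of the column containing [D]: sets on a detour are those whose trace on [S0] is not in
    [Y], and their column is found by putting [w] back. *)
Let tag D := let c := D :&: S0 in if c \in Y then c else w |: c.

Lemma in_gs g : (g \in L :: gs) = (g \subset L).
Proof. by case: gsP => _ _ ->; rewrite powersetE. Qed.

Lemma mem_column y D : reflect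
  [\/ D = hd y, exists2 g : {set G}, g \subset L & D = row y g |
      detour y /\ exists2 g : {set G}, g \subset L & D = row (y :\ w) g]
  (D \in hd y :: tl y).
Proof.
apply: (iffP idP).
  rewrite inE => /orP[/eqP|]; first by constructor 1.
  rewrite inE => /orP[/eqP|]; first by constructor 2; exists L.
  rewrite mem_cat => /orP[|/mapP[g gg ->]]; last first.
    by constructor 2; exists g; rewrite // -in_gs inE gg orbT.
  case: ifP => // dy /mapP[g]; rewrite inE mem_rev -in_cons in_gs => gL ->.
  by constructor 3; split=> //; exists g.
case=> [->|[g]|[dy [g]]]; first exact: mem_head.
  rewrite -in_gs inE => /orP[/eqP->|gg] ->; first by rewrite !inE eqxx orbT.
  by rewrite !inE mem_cat (map_f _ gg) !orbT.
rewrite -in_gs => gg ->; rewrite !in_cons mem_cat dy (map_f (row _)) ?orbT //.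
by rewrite inE mem_rev.
Qed.

Lemma S0N : [disjoint S0 & v |: L].
Proof. by rewrite disjoints_subset subsetDr. Qed.

Lemma restrict y K : y \subset S0 -> K \subset v |: L -> (y :|: K) :&: S0 = y.
Proof.
move=> yS KL; rewrite setIUl (setIidPl yS).
suff -> : K :&: S0 = set0 by rewrite setU0.
by apply/eqP; rewrite setI_eq0 disjoint_sym (disjointWr KL) ?S0N.
Qed.

Lemma restrict_hd y : y \subset S0 -> hd y :&: S0 = y.
Proof. by move=> yS; rewrite restrict ?subsetUr. Qed.

Lemma restrict_row y g : y \subset S0 -> g \subset L -> row y g :&: S0 = y.
Proof. by move=> yS gL; rewrite restrict ?setUS. Qed.

Lemma center_row y g : v \in row y g.
Proof. by rewrite !inE eqxx orbT. Qed.

Lemma center_hd y : y \subset S0 -> v \notin hd y.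
Proof.
move=> yS; rewrite inE negb_or star_centerN andbT.
by apply/negP=> /(subsetP yS); rewrite !inE eqxx.
Qed.

Lemma doms_sub R D : D \in doms S0 R -> D \subset S0.
Proof. by case/domsP. Qed.

Lemma detourP y : detour y ->
  [/\ w \in y, y :\ w \in X, (y :\ w \in Y) = false & w |: (y :\ w) = y].
Proof. by case/andP=> wy; rewrite inE => /andP[/negbTE-> ->]; rewrite setD1K. Qed.

Lemma tag_column y D : y \in Y -> D \in hd y :: tl y -> tag D = y.
Proof.
move=> yY; have yS := doms_sub yY.
case/mem_column=> [->|[g gL ->]|[/detourP[wy yX yY' yE] [g gL ->]]]; rewrite /tag.
- by rewrite restrict_hd ?yY.
- by rewrite restrict_row ?yY.
- by rewrite restrict_row ?(doms_sub yX) // yY'.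
Qed.

Lemma row_sub y g : y \subset S0 -> g \subset L -> row y g \subset S.
Proof.
move=> yS gL; rewrite !subUset sub1set (star_center st).
by rewrite (subset_trans yS (subsetDl _ _)) (subset_trans gL (star_leaves st)).
Qed.

Lemma row_dom y g : y \in X -> g \subset L -> row y g \in doms S S.
Proof.
move=> yX gL; have yS := doms_sub yX.
by rewrite doms_star ?row_sub // center_row restrict_row.
Qed.

Lemma subYX y : y \in Y -> y \in X.
Proof.
by case/domsP=> yS dy; apply/domsP; split=> // u /setD1P[_]; apply: dy.
Qed.

(* A set in [X :\: Y] leaves only [w] undominated, and adding [w] repairs this. *)
Lemma root_repair y : y \in X -> y \notin Y -> (w |: y \in Y) /\ w \notin y.
Proof.
move=> /domsP[yS dy] yY.
have /andP[wS nwd] : (w \in S0) && ~~ dominated y w.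
  apply: contraNT yY; rewrite negb_and negbK => wN.
  apply/domsP; split=> // u uS; have [uw|uw] := eqVneq u w.
    by rewrite uw in uS *; rewrite uS in wN.
  by apply: dy; rewrite in_setD1 uw.
split; last by apply: contra nwd => wy; apply/orP; left.
apply/domsP; split; first by rewrite subUset sub1set wS.
move=> u uS; have [->|uw] := eqVneq u w; first by rewrite /dominated setU11.
by apply: (dominatedS (subsetUr _ _)); apply: dy; rewrite in_setD1 uw.
Qed.

Lemma column_dom D :
  (exists2 y, y \in Y & D \in hd y :: tl y) <-> D \in doms S S.
Proof.
split=> [[y yY]|].
  have yS := doms_sub yY.
  case/mem_column=> [->|[g gL ->]|[/detourP[wy yX _ _] [g gL ->]]].
  - rewrite doms_star; last first.
      by rewrite subUset (star_leaves st) (subset_trans yS (subsetDl _ _)).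
    by rewrite (negbTE (center_hd yS)) subsetUr restrict_hd.
  - exact: (row_dom (subYX yY)).
  - exact: row_dom.
move=> dD; have /domsP[DS _] := dD; move: dD; rewrite doms_star //.
have DE : D = D :&: S0 :|: D :&: (v |: L).
  rewrite -setIUr; apply/esym/setIidPl; apply: (subset_trans DS).
  by rewrite setUC -subDset.
case: ifP => vD; last first.
  case/andP=> LD DY; exists (D :&: S0) => //; apply/mem_column; constructor 1.
  rewrite {1}DE /hd; congr (_ :|: _); apply/setP=> x; rewrite !inE.
  have [->|_] := eqVneq x v; first by rewrite vD (negbTE star_centerN).
  by case: (boolP (x \in L)) => [/(subsetP LD)->|]; rewrite ?andbF.
move=> DX; have DE' : D = row (D :&: S0) (D :&: L).
  by rewrite {1}DE setIUr; congr (_ :|: (_ :|: _)); apply/setIidPr; rewrite sub1set.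
have [DY|DY] := boolP (D :&: S0 \in Y).
  exists (D :&: S0) => //; apply/mem_column; constructor 2.
  by exists (D :&: L); rewrite ?subsetIr.
(* A trace in [X] but not in [Y] is visited by the detour in the column of the repaired set. *)
have [wDY wD] := root_repair DX DY; exists (w |: D :&: S0) => //.
apply/mem_column; constructor 3; rewrite /detour setU1K // setU11 inE DY; split=> //.
by exists (D :&: L); rewrite ?subsetIr.
Qed.

Lemma flip_row y : y \subset S0 ->
  {in [in L :: gs] &, forall g h, flip (row y g) (row y h) = flip g h}.
Proof.
move=> yS g h; rewrite !inE -!in_cons !in_gs => gL hL.
have dis (k : {set G}) : k \subset L -> [disjoint y & v |: k] && [disjoint [set v] & k].
  move=> kL; rewrite (disjointWl yS) ?(disjointWr (setUS _ kL)) ?S0N //=.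
  by rewrite disjoints1; apply: contra star_centerN; apply: subsetP.
have [/andP[g1 g2] /andP[h1 h2]] := (dis g gL, dis h hL).
by rewrite !flipUr.
Qed.

Lemma flip_base y z K : y \subset S0 -> z \subset S0 -> K \subset v |: L ->
  flip y z -> flip (y :|: K) (z :|: K).
Proof.
move=> yS zS KL yz; rewrite ![_ :|: K]setUC flipUr //.
  by rewrite disjoint_sym (disjointW yS KL S0N).
by rewrite disjoint_sym (disjointW zS KL S0N).
Qed.

(** A cyclic code with the single term [L] would make [L] differ from itself. The second term is
    where a detour returns to its column. *)
Lemma gs_neq0 : gs != [::].
Proof. by apply: contraL gs_cycle => /eqP->; rewrite flip_irrefl. Qed.

(** The bottom of a column is independent of whether it has a detour, so the bottoms of columns over
    adjacent bases are adjacent. *)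
Lemma last_tl y : last (hd y) (tl y) = row y (last L gs).
Proof.
by rewrite /tl; case: gs gs_neq0 => // g1 gs1 _; rewrite /= last_cat /= last_map.
Qed.

Lemma path_row y s g : y \subset S0 -> {subset g :: s <= L :: gs} ->
  path (@flip G) g s -> path (@flip G) (row y g) (map (row y) s).
Proof.
move=> yS sg; rewrite (mono_path_in (flip_row yS)) //; exact/allP.
Qed.

(* The detour replaces the edge between the first two sets of the Gray code by
   the Gray cycle run backwards, one level below. *)
Lemma column_path y : y \in Y -> path (@flip G) (hd y) (tl y).
Proof.
move=> yY; have yS := doms_sub yY; have [pgs _ _] := gsP; rewrite /= in pgs.
rewrite /tl /=; apply/andP; split.
  by rewrite flip_sym /row /hd setUCA flipU1 ?center_hd.
case: ifP => [dy|_]; last exact: path_row.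
have [wy yX _ yE] := detourP dy; have yS' := doms_sub yX.
have fw g : g \subset L -> flip (row y g) (row (y :\ w) g).
  move=> gL; rewrite flip_base ?setUS //; last by rewrite -{1}yE flipU1 ?setD11.
(* This is the closed walk [L], [gs], [L] read backwards, where the cyclic closure of the code
   enters. *)
have rgs : path (@flip G) L (rcons (rev gs) L).
  have := rev_path (@flip G) L (rcons gs L).
  rewrite last_rcons belast_rcons rev_cons => ->.
  rewrite (eq_path (e' := @flip G)) => [|g h]; last exact: flip_sym.
  by rewrite rcons_path pgs.
rewrite /= fw //= cat_path; apply/andP; split.
  apply: path_row => //; first by move=> g; rewrite !inE mem_rev.
  by move: rgs; rewrite rcons_path => /andP[].
have := path_row yS (fun _ => id) pgs; rewrite last_map.
case: gs gs_neq0 in_gs => // g1 gs' _ gsE /= /andP[_ ->].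
by rewrite rev_cons last_rcons flip_sym fw // -gsE !inE eqxx orbT.
Qed.

Lemma row_inj y : y \subset S0 -> {in [in L :: gs] &, injective (row y)}.
Proof.
move=> yS g h; rewrite !inE -!in_cons !in_gs => gL hL /(congr1 (fun D => D :&: L)).
suff rowI (k : {set G}) : k \subset L -> row y k :&: L = k by rewrite !rowI.
move=> kL; apply/setP=> x; rewrite !inE.
have [xL|xL] := boolP (x \in L); last first.
  by rewrite andbF; apply/esym/negP=> /(subsetP kL); apply/negP.
rewrite andbT; have [xv|_] := eqVneq x v; first by rewrite xv (negbTE star_centerN) in xL.
by case: (boolP (x \in y)) => // /(subsetP yS); rewrite !inE xL orbT.
Qed.

(** The top set avoids [v], unlike all the others; detour sets avoid [w], which belongs to [y];
    within one level, rows of distinct subsets of [L] are distinct. *)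
Lemma column_uniq y : y \in Y -> uniq (hd y :: tl y).
Proof.
move=> yY; have yS := doms_sub yY; have [_ ugs _] := gsP.
have urow z : z \subset S0 -> uniq [seq row z g | g <- L :: gs].
  by move=> zS; rewrite map_inj_in_uniq //; apply: row_inj.
rewrite cons_uniq; apply/andP; split.
  apply: contra (center_hd yS); rewrite inE mem_cat.
  case/or3P=> [/eqP->||/mapP[g _ ->]]; try exact: center_row.
  by case: ifP => // _ /mapP[g _ ->]; apply: center_row.
(* Moving the detour to the front reunites the row of [L] with the rows of [gs]. *)
rewrite /tl -cat1s uniq_catCA cat_uniq [_ ++ _]/= urow // andbT.
case: ifP => [dy|_]; last by rewrite /= -all_predC all_predT.
have [wy yX _ _] := detourP dy; have yS' := doms_sub yX.
apply/andP; split.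
  rewrite (perm_uniq (s2 := [seq row (y :\ w) g | g <- L :: gs])) ?urow //.
  by apply: perm_map; rewrite perm_cons perm_rev.
rewrite -[row y L :: _]/[seq row y g | g <- L :: gs].
apply/hasPn=> D /mapP[g gg DE]; apply/negP=> /mapP[h hh].
rewrite DE => /(congr1 (fun Z => w \in Z :&: S0)).
rewrite !restrict_row ?wy ?setD11 // -in_gs //.
by move: hh; rewrite !inE mem_rev.
Qed.

Lemma star_snake p : ham_listing Y p -> exists q, ham_listing (doms S S) q.
Proof.
(* [S0] dominates itself, so the listing is nonempty and there is a first column. *)
case=> sp up mp; have : S0 \in Y.
  by apply/domsP; split=> // u uS; rewrite /dominated uS.
rewrite -mp; case: p sp up mp => // y ys sp up mp _.
have sub z : z \in y :: ys -> z \subset S0 by rewrite mp => /doms_sub.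
exists (snake_hd hd tl false y :: snake_tl hd tl false y ys); split.
- apply: (@snake_path _ _ (@flip G) (@flip G) hd tl (@flip_sym G)
            false y ys _ _ sp) => [z|b z t zp tp zt].
    by rewrite mp => /column_path.
  rewrite /snake_hd !last_tl; case: b; apply: flip_base; rewrite ?sub ?subsetUr //.
  by rewrite setUS // -in_gs mem_last.
- apply: (snake_uniq (tag := tag)) up => [z|z D]; rewrite mp.
    exact: column_uniq.
  exact: tag_column.
- move=> D; apply/idP/idP => [/mem_snake[z]|/column_dom[z]].
    by rewrite mp => zY Dz; apply/column_dom; exists z.
  by rewrite -mp => zp Dz; apply: sub_snake zp Dz.
Qed.

End Star.

Lemma star_ham_listing S L v w p : pendant_star S v L w ->
  ham_listing (doms (S :\: (v |: L)) (S :\: (v |: L))) p ->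
  exists q, ham_listing (doms S S) q.
Proof.
move=> st; have [gs [gsP gs_cycle]] := gray_cycle (star_leaves0 st).
exact: (star_snake st gsP gs_cycle).
Qed.

(** An isolated vertex lies in every dominating set and dominates only itself, so adding it is a
    bijection of dominating sets that preserves flips. *)
Lemma isolated_ham_listing S v p : v \in S -> {in S, forall u, ~~ adj v u} ->
  ham_listing (doms (S :\ v) (S :\ v)) p ->
  ham_listing (doms S S) [seq v |: D | D <- p].
Proof.
move=> vS iso [sp up mp]; have vp D : D \in p -> v \notin D.
  by rewrite mp => /domsP[/subsetD1P[]].
split.
- have flipv : {in [in p] &, forall X Y, flip (v |: X) (v |: Y) = flip X Y}.
    by move=> X Y /vp vX /vp vY; rewrite flipUr // disjoints1.
  by rewrite (mono_sorted_in flipv) //; apply/allP.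
- rewrite map_inj_in_uniq // => X Y /vp vX /vp vY /(congr1 (fun Z => Z :\ v)).
  by rewrite !setU1K.
move=> D; apply/mapP/domsP => [[E]|[DS dD]].
  rewrite mp => /domsP[ES dE] ->; split.
    by rewrite subUset sub1set vS (subset_trans ES (subsetDl _ _)).
  move=> u uS; have [->|uv] := eqVneq u v; first by rewrite /dominated setU11.
  by apply: (dominatedS (subsetUr _ _)); apply: dE; rewrite in_setD1 uv.
have vD : v \in D.
  have /orP[//|/exists_inP[z zD]] := dD v vS.
  by rewrite (negbTE (iso z (subsetP DS z zD))).
exists (D :\ v); last by rewrite setD1K.
rewrite mp; apply/domsP; split; first exact: setSD.
move=> u /setD1P[uv uS]; have /orP[uD|/exists_inP[z zD uz]] := dD u uS.
  by apply/orP; left; rewrite in_setD1 uv.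
apply/orP; right; apply/exists_inP; exists z => //; rewrite in_setD1 zD andbT.
by apply/eqP=> zv; rewrite zv adj_sym (negbTE (iso u uS)) in uz.
Qed.

(** * Longest paths and the induction on forests *)

Section Acyclic.
Hypothesis acG : acyclic_graph G.

(** The edge from [u] back to [x] would close the initial segment up to [u] into a cycle; as [y]
    lies strictly between them, it has at least three vertices. *)
Lemma acyclic_chord x y p u : path (@adj G) x (y :: p) -> uniq (x :: y :: p) ->
  u \in p -> ~~ adj x u.
Proof.
move=> xyp uxyp up; apply/negP=> xu; case/path.splitP: up xyp uxyp => p1 p2 xyp uxyp.
suff /acG : ucycle (@adj G) (x :: y :: rcons p1 u) by rewrite /= size_rcons.
rewrite /ucycle; move: xyp uxyp; rewrite -!cat_cons cat_path cat_uniq.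
move=> /andP[xp _] /andP[-> _]; rewrite andbT (cycle_path x) [last _ _]/= last_rcons.
by rewrite [path _ _ _]/= adj_sym xu.
Qed.

Definition path_in S (s : seq G) :=
  [&& sorted (@adj G) s, uniq s & all [in S] s].

Lemma longest_path_in S x : x \in S ->
  exists2 s, path_in S s & forall t, path_in S t -> size t <= size s.
Proof.
(* Tuples make the existence of a path with [n] vertices a boolean predicate; since vertices do not
   repeat, it fails beyond [#|G|]. *)
move=> xS; pose P n := [exists s : n.-tuple G, path_in S s].
have exP : exists n, P n.
  by exists 1; apply/existsP; exists [tuple x]; rewrite /path_in /= xS.
have maxP n : P n -> n <= #|G|.
  case/existsP=> s /and3P[_ us _]; rewrite -(size_tuple s) -(card_uniqP us).
  exact: max_card.
case: (ex_maxnP exP maxP) => n /existsP[s sP] nmax; exists s => // t tP.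
rewrite size_tuple; apply: nmax; apply/existsP; by exists (in_tuple t).
Qed.

(** Another neighbour of the endpoint [x] would be a chord if on the path, and would prolong the
    path if off it. *)
Lemma longest_path_leaf S x y p : path_in S (x :: y :: p) ->
    (forall t, path_in S t -> size t <= size (x :: y :: p)) ->
  {in S, forall u, adj x u -> u = y}.
Proof.
move=> /and3P[sp up ap] lmax u uS xu; apply/eqP/negPn/negP=> uy.
have [uin|uout] := boolP (u \in x :: y :: p).
  move: uin; rewrite !inE (negbTE uy) /=; case/orP=> [/eqP ux|uinp].
    by rewrite ux adj_irrefl in xu.
  by move/negP: (acyclic_chord sp up uinp).
have := lmax (u :: x :: y :: p); rewrite ltnn => /(_ _)/negP; apply; last by [].
apply/and3P; split; first by rewrite /= adj_sym xu.
  by rewrite cons_uniq uout.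
by rewrite /= uS.
Qed.

Lemma exists_pendant_star S x : x \in S ->
    {in S, forall y, exists2 z, z \in S & adj y z} ->
  exists v L w, pendant_star S v L w.
Proof.
move=> xS noiso; have [s sS smax] := longest_path_in xS.
case: s sS smax => [|x0 [|x1 p]] sS smax.
- by have := smax [:: x]; rewrite /path_in /= xS => /(_ isT).
- have x0S : x0 \in S by case/and3P: sS => _ _ /andP[].
  have [z zS xz] := noiso _ x0S.
  have := smax [:: x0; z]; rewrite /path_in /= xz x0S zS inE /= !andbT.
  by case: eqVneq xz => [->|_ _ /(_ isT)//]; rewrite adj_irrefl.
pose L := [set l in S | adj x1 l & [forall u in S, adj l u ==> (u == x1)]].
have inL l : reflect [/\ l \in S, adj x1 l & {in S, forall u, adj l u -> u = x1}]
                     (l \in L).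
  rewrite inE; apply: (iffP and3P) => -[lS x1l lL]; split=> //.
    by move=> u uS lu; apply/eqP; move/forall_inP/(_ u uS)/implyP: lL; apply.
  by apply/forall_inP=> u uS; apply/implyP=> /(lL u uS)->.
have /and3P[/= /andP[x01 sp] /andP[x0p up] /and3P[x0S x1S pS]] := sS.
(* When the path stops at [x1], the default [x1] serves as [w]: it is not in the remaining forest,
   so [star_root] holds vacuously. *)
exists x1, L, (head x1 p); split=> //.
- by apply/subsetP=> l /inL[].
- apply/set0Pn; exists x0; apply/inL; split=> //; first by rewrite adj_sym.
  exact: longest_path_leaf smax.
- by move=> l /inL[].
- by move=> l u /inL[_ _ lL] uS; apply: lL.
- move=> u uS x1u; have [up'|uNp] := boolP (u \in x1 :: p).
    right; move: up'; rewrite inE => /orP[/eqP ux|].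
      by rewrite ux adj_irrefl in x1u.
    case: p sp up {smax sS x0p pS} => // x2 p sp up; rewrite inE => /orP[/eqP//|up'].
    by move/negP: (acyclic_chord sp up up').
  (* Replacing [x0] by [u] gives a path of the same maximal length, so its endpoint [u] is a leaf
     too. *)
  left; apply/inL; split=> //; apply: (longest_path_leaf (p := p)) => //.
  by apply/and3P; split; rewrite /= ?uNp ?uS ?x1S // adj_sym x1u.
by case: p sp {smax sS x0p up pS} => [|x2 p] /=; [rewrite !inE eqxx|case/andP].
Qed.

(** Strong induction on the size of [S] inside the fixed graph [G]: subforests are represented by
    their vertex sets, so no new graphs are built. *)
Lemma forest_ham_listing S : exists p, ham_listing (doms S S) p.
Proof.
have [n] := ubnP #|S|; elim: n S => // n IH S; rewrite ltnS => Sn.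
have IHs v R : v \in S -> R \subset S -> v \notin R -> exists p, ham_listing (doms R R) p.
  move=> vS RS vR; apply: IH; apply: leq_trans Sn; apply: proper_card.
  by apply/properP; split=> //; exists v.
have [S0|[x xS]] := set_0Vmem S.
  exists [:: set0]; split=> // D; rewrite inE S0; apply/eqP/domsP => [->|[]].
    by split=> // u; rewrite inE.
  by rewrite subset0 => /eqP.
have [/exists_inP[v vS /forall_inP iso]|noiso] :=
  boolP [exists v in S, [forall u in S, ~~ adj v u]].
  have [p pP] := IHs v (S :\ v) vS (subsetDl _ _) (negbT (setD11 _ _)).
  by eexists; apply: (isolated_ham_listing vS iso pP).
have [v [L [w st]]] : exists v L w, pendant_star S v L w.
  apply: exists_pendant_star xS _ => y yS.
  move: noiso; rewrite negb_exists_in => /forall_inP/(_ y yS).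
  by rewrite negb_forall_in => /exists_inP[z zS /negPn yz]; exists z.
have [] := IHs v (S :\: (v |: L)) (star_center st) (subsetDl _ _).
  by rewrite !inE eqxx.
by move=> p /(star_ham_listing st).
Qed.

End Acyclic.

End Domination.

(** * Transfer to the dominating graph *)

Theorem theorem1p4 (T : sgraph) (hT : is_tree T) :
  has_hamilton_path (dominating_graph T).
Proof.
have [_ acT] := hT; have [p [sp up mp]] := forest_ham_listing acT [set: T].
have pdom D : D \in p = dominating D.
  rewrite mp inE subsetT; apply: eq_forallb => u.
  by rewrite inE /dominated; case: (u \in D).
(* The vertices of the dominating graph are sets packed with a proof of domination, so the listing
   is lifted entry by entry. *)
have [q Eq] : exists q : seq (dom_set T), map val q = p.
  have : all (@dominating T) p by apply/allP=> D; rewrite pdom.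
  elim: p {sp up mp pdom} => [|D p IH] /=; first by exists [::].
  by case/andP=> dD /IH[q <-]; exists (exist _ D dD :: q).
have mq Y : Y \in q by rewrite -(mem_map val_inj) Eq pdom (valP Y).
(* The full vertex set is dominating, which rules out an empty listing and yields the starting
   vertex. *)
have dT : dominating [set: T] by apply/forallP=> u; rewrite inE.
move: (mq (Sub [set: T] dT)); case: q Eq mq => // X q Eq mq _.
exists X, q; split=> //; last by rewrite -(map_inj_uniq val_inj) Eq.
by move: sp; rewrite -Eq /= path_map.
Qed.
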